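(* The trivial variety $TR$ and the variety $Z$ of all zero semigroups (the variety of semigroups defined by the identity $xy\approx zt$) are the only $sa$-solid varieties of semigroups; that is, a variety $V$ of semigroups is $sa$-solid if and only if $V=TR$ or $V=Z$.
   Context: The type is $\tau=(2)$ with one binary operation symbol $f$. $W_{(2)}(X)$ is the set of terms of this type over $X=\{x_1,x_2,\ldots\}$ (also written $x,y,z,t,\ldots$). A hypersubstitution $\sigma$ of type $(2)$ assigns to $f$ a term $\sigma(f)\in W_{(2)}(\{x_1,x_2\})$; $Hyp(2)$ is the set of all of them. For a term $u$ over $\{x_1,x_2\}$, $S^2(u,t_1,t_2)$ is the term obtained from $u$ by simultaneously substituting $t_1$ for $x_1$ and $t_2$ for $x_2$. For $\sigma\in Hyp(2)$, mappings $\sigma^{fa},\sigma^{sa}:W_{(2)}(X)\to W_{(2)}(X)$ are defined by simultaneous recursion: $\sigma^{fa}(x):=\sigma^{sa}(x):=x$ for $x\in X$; and $\sigma^{fa}(f(t_1,t_2)):=S^2(\sigma(f),\sigma^{sa}(t_1),\sigma^{sa}(t_2))$, $\sigma^{sa}(f(t_1,t_2)):=f(\sigma^{fa}(t_1),\sigma^{fa}(t_2))$. A variety of semigroups is a variety of algebras of type $(2)$ satisfying the associative law; $IdV$ is the set of all identities $s\approx t$ (with $s,t\in W_{(2)}(X)$) holding in $V$. $V$ is called $sa$-solid iff $\sigma^{sa}(s)\approx\sigma^{sa}(t)\in IdV$ for all $s\approx t\in IdV$ and all $\sigma\in Hyp(2)$. In semigroup identities the symbol $f$ and brackets are omitted.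 *)

(* Defs.v *)
From HB Require Import structures.
From mathcomp Require Import all_boot.
Set Implicit Arguments.
Unset Strict Implicit.
Unset Printing Implicit Defensive.

Local Open Scope group_scope.

(* Algebras of type (2) are the inhabitants of [magmaType], which puts no
   structure on the carrier besides the binary operation. *)

Inductive term (X : Type) : Type :=
| Var of X
| App of term X & term X.

(* Terms over the alphabet x_1, x_2, ...; the variable x_(i+1) is [Var i]. *)
Definition W := term nat.

(* A hypersubstitution of type (2) is determined by the term sigma(f) over the
   two-letter alphabet {x_1, x_2}: here x_1 is [Var ord0], x_2 is
   [Var ord_max]. *)
Definition Hyp := term 'I_2.

Fixpoint S2 (u : term 'I_2) (t1 t2 : W) : W :=
  match u with
  | Var i => if i == ord0 then t1 else t2
  | App u1 u2 => App (S2 u1 t1 t2) (S2 u2 t1 t2)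
  end.

Fixpoint hyp_fa (sigma : Hyp) (t : W) {struct t} : W :=
  match t with
  | Var i => Var i
  | App t1 t2 => S2 sigma (hyp_sa sigma t1) (hyp_sa sigma t2)
  end
with hyp_sa (sigma : Hyp) (t : W) {struct t} : W :=
  match t with
  | Var i => Var i
  | App t1 t2 => App (hyp_fa sigma t1) (hyp_fa sigma t2)
  end.

Fixpoint eval (A : magmaType) (v : nat -> A) (t : W) : A :=
  match t with
  | Var i => v i
  | App t1 t2 => eval v t1 * eval v t2
  end.

Definition satisfies (A : magmaType) (s t : W) : Prop :=
  forall v : nat -> A, eval v s = eval v t.

Definition class := magmaType -> Prop.

Definition eq_class (V V' : class) : Prop := forall A, V A <-> V' A.

(* The models of a set of identities; carriers of algebras are nonempty. *)
Definition Mod (E : W -> W -> Prop) : class :=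
  fun A => inhabited A /\ forall s t, E s t -> satisfies A s t.

Definition variety (V : class) : Prop := exists E, eq_class V (Mod E).

Definition semigroup_variety (V : class) : Prop :=
  variety V /\ forall A, V A -> associative (@mul A).

Definition Id (V : class) (s t : W) : Prop := forall A, V A -> satisfies A s t.

Definition sa_solid (V : class) : Prop :=
  forall s t, Id V s t ->
  forall sigma : Hyp, Id V (hyp_sa sigma s) (hyp_sa sigma t).

Definition TR : class := fun A => exists a : A, forall b : A, b = a.

Definition ZeroSg : class := fun A =>
  [/\ inhabited A, associative (@mul A) & forall x y z t : A, x * y = z * t].

Lemma TR_semigroup_variety : semigroup_variety TR.
Proof.
split; last by move=> A [a aP] x y z; rewrite [LHS]aP [RHS]aP.
exists (fun s t : W => s = Var 0%N /\ t = Var 1%N) => A; split.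
  move=> [a aP]; split; first exact: (inhabits a).
  by move=> s t _ v; rewrite [LHS]aP [RHS]aP.
move=> [[a] sat]; exists a => b.
by have /(_ (fun i => if i is 0 then b else a)) := sat _ _ (conj erefl erefl).
Qed.

Lemma ZeroSg_semigroup_variety : semigroup_variety ZeroSg.
Proof.
split; last by move=> A [].
pose x i : W := Var i.
exists (fun s t : W =>
  (s = App (x 0%N) (App (x 1%N) (x 2%N)) /\ t = App (App (x 0%N) (x 1%N)) (x 2%N))
  \/ (s = App (x 0%N) (x 1%N) /\ t = App (x 2%N) (x 3%N))) => A; split.
  move=> [iA assocA zA]; split=> // s t [] [-> ->] v /=; first exact: assocA.
  exact: zA.
move=> [iA sat]; split=> //.
  move=> a b c; exact: (sat _ _ (or_introl (conj erefl erefl))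
    (fun i => nth c [:: a; b; c] i)).
move=> a b c d; exact: (sat _ _ (or_intror (conj erefl erefl))
  (fun i => nth d [:: a; b; c; d] i)).
Qed.

(* Main.v *)
From HB Require Import structures.
Require Import Defs.
From mathcomp Require Import all_boot.
From Stdlib Require Import Classical.

(** The images of the associative law under the two projections
    [f |-> x_1] and [f |-> x_2] are [xy = xz] and [xz = yz], so an sa-solid
    variety of semigroups lies below the zero semigroups. Conversely, in a
    nontrivial zero semigroup only trivial identities and identities between two
    compound terms hold; [sigma^sa] preserves both kinds, and every zero semigroup
    satisfies them, so there is no variety strictly between TR and Z. *)

Local Open Scope group_scope.

Definition compound {X : Type} (t : term X) : bool :=
  if t is App _ _ then true else false.

Lemma zero_satisfies_compound {A : magmaType} {s t : W} :
  (forall x y z u : A, x * y = z * u) -> compound s -> compound t ->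
  satisfies A s t.
Proof. by case: s => // s1 s2; case: t => // t1 t2 zA _ _ v; apply: zA. Qed.

(** A compound term takes a single value under all valuations, whereas a variable takes both [a] and
    [b]. Two distinct variables are told apart by sending one to [a] and the other to [b]. *)
Lemma zero_nontrivial_identity {A : magmaType} {a b : A} {s t : W} :
  (forall x y z u : A, x * y = z * u) -> a <> b -> satisfies A s t ->
  s = t \/ (compound s /\ compound t).
Proof.
move=> zA ab; case: s t => [i|s1 s2] [j|t1 t2] sat.
- have [-> //|ij] := eqVneq i j; first by left.
  have := sat (fun k => if k == i then a else b).
  by rewrite /= eqxx eq_sym (negbTE ij).
- by case: ab; rewrite [LHS](sat (fun=> a)) [RHS](sat (fun=> b)); apply: zA.
- by case: ab; rewrite -[LHS](sat (fun=> a)) -[RHS](sat (fun=> b)); apply: zA.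
- by right.
Qed.

(** A synonym keeps the constant product off [bool] itself. One nontrivial model suffices to
    restrict the identities of [ZeroSg]. *)
Definition zero_bool : Type := bool.
HB.instance Definition _ := Choice.copy zero_bool bool.
HB.instance Definition _ :=
  hasMul.Build zero_bool (fun _ _ : zero_bool => false).

Lemma ZeroSg_zero_bool : ZeroSg zero_bool.
Proof. by split=> //; exact: (inhabits true). Qed.

Lemma TR_satisfies (A : magmaType) (s t : W) : TR A -> satisfies A s t.
Proof. by move=> [a aP] v; rewrite [LHS]aP [RHS]aP. Qed.

Lemma sa_solid_eq_class {V V' : class} :
  eq_class V V' -> sa_solid V' -> sa_solid V.
Proof.
move=> VV' solV' s t st sigma A /VV' VA.
by apply: (solV' s t _ sigma A VA) => B /VV'; apply: st.
Qed.

Lemma sa_solid_TR : sa_solid TR.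
Proof. by move=> s t _ sigma A; apply: TR_satisfies. Qed.

Lemma sa_solid_ZeroSg : sa_solid ZeroSg.
Proof.
move=> s t st sigma A [_ _ zA].
have [_ _ zB] := ZeroSg_zero_bool.
have tf : (true : zero_bool) <> (false : zero_bool) by [].
have [-> //|[cs ct]] := zero_nontrivial_identity zB tf (st _ ZeroSg_zero_bool).
(* [hyp_sa] keeps the outermost [f] whatever [sigma] is. *)
by apply: zero_satisfies_compound => //; [case: (s) cs | case: (t) ct].
Qed.

Lemma sa_solid_zero {V : class} {A : magmaType} :
    (forall B, V B -> associative (@mul B)) -> sa_solid V -> V A ->
  forall x y z u : A, x * y = z * u.
Proof.
move=> assocV solV VA x y z u.
have assocId : Id V (App (Var 0%N) (App (Var 1%N) (Var 2%N)))
                    (App (App (Var 0%N) (Var 1%N)) (Var 2%N)).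
  by move=> B VB v /=; apply: assocV.
(* Only the inner product collapses: [Var ord0] sends x(yz) to xy and (xy)z to xz, and [Var ord_max]
   sends them to xz and yz. The default [r] of [nth] is the value of z. *)
have mulxC (p q r : A) : p * q = p * r.
  exact: (solV _ _ assocId (Var ord0) A VA (nth r [:: p; q])).
have mulCx (p q r : A) : p * r = q * r.
  exact: (solV _ _ assocId (Var ord_max) A VA (nth r [:: p; q])).
by rewrite (mulxC x y u); apply: mulCx.
Qed.

Lemma zero_variety_TR_or_ZeroSg (V : class) :
  variety V -> (forall A, V A -> ZeroSg A) -> eq_class V TR \/ eq_class V ZeroSg.
Proof.
move=> [E VE] VZ.
have [[A [VA [a [b ab]]]]|trivV] :=
  classic (exists A, V A /\ exists a b : A, a <> b).
  right=> B; split=> [|[iB _ zB]]; first exact: VZ.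
  have [_ _ zA] := VZ _ VA; have [_ satA] := (VE A).1 VA.
  (* Every axiom in [E] holds in the nontrivial [A], so it is of a kind that holds in [B] too. *)
  apply/VE; split=> // s t /satA st.
  have [-> //|[cs ct]] := zero_nontrivial_identity zA ab st.
  exact: zero_satisfies_compound.
left=> A; split=> [VA | trA].
  have [[a] _ _] := VZ _ VA; exists a => b; apply: NNPP => ba.
  by apply: trivV; exists A; split=> //; exists b, a.
apply/VE; split=> [|s t _]; last exact: TR_satisfies.
by case: trA => a _; apply: (inhabits a).
Qed.

Theorem theorem2 (V : class) (hV : semigroup_variety V) :
  sa_solid V <-> (eq_class V TR \/ eq_class V ZeroSg).
Proof.
have [varV assocV] := hV; split=> [solV|[] eqV]; last 2 first.
- exact: sa_solid_eq_class eqV sa_solid_TR.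
- exact: sa_solid_eq_class eqV sa_solid_ZeroSg.
apply: zero_variety_TR_or_ZeroSg => // A VA.
split; [|exact: assocV|exact: sa_solid_zero assocV solV VA].
by have [E VE] := varV; have [] := (VE A).1 VA.
Qed.
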